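(* Let $\mathcal{V}=\operatorname{span}\{v_i\}_{i=1}^M$, $\mathcal{W}$, $\mathcal{W}^\perp$, $\mathcal{S}=\mathcal{V}+\mathcal{W}^\perp=\mathcal{W}\oplus\mathcal{W}^\perp$ with $\mathcal{V}\cap\mathcal{W}^\perp=\{0\}$, and $u_i=v_i-\hat P_{\mathcal{W}^\perp}v_i$, be as described in the context, and let $f\in\mathcal{S}$. Let $J=\{1,\dots,M\}$, let $J_k\subset J$ be the set of the $k$ previously chosen indices, and let $\mathcal{W}_k=\operatorname{span}\{u_i\}_{i\in J_k}$. For $n\in J\setminus J_k$ put $\gamma_n=u_n-\hat P_{\mathcal{W}_k}u_n$, and let $\mathcal{W}_{k+1}=\mathcal{W}_k+\operatorname{span}\{u_n\}$ be the subspace obtained by selecting the index $n$. Then, among the indices $n\in J\setminus J_k$ with $\gamma_n\neq 0$, the index $\ell_{k+1}=n$ for which $$\|\hat P_{\mathcal{W}}f-\hat P_{\mathcal{W}_{k+1}}f\|^2$$ is minimal is determined by $$\ell_{k+1}=\arg\max_{n\in J\setminus J_k,\ \gamma_n\neq 0}\ \frac{|\langle \gamma_n,f\rangle|}{\|\gamma_n\|};$$ that is, an admissible index minimizes the former quantity if and only if it maximizes the latter.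
   Context: $\mathcal{H}$ is a complex inner product space with inner product $\langle\cdot,\cdot\rangle$ (conjugate-linear in the first argument, linear in the second) and induced norm $\|\cdot\|$. $\mathcal{V}\subset\mathcal{H}$ is a finite-dimensional subspace with spanning set $\{v_i\}_{i=1}^M$, and $\mathcal{W}^\perp\subset\mathcal{H}$ is a closed subspace with $\mathcal{V}\cap\mathcal{W}^\perp=\{0\}$. Put $\mathcal{S}=\mathcal{V}+\mathcal{W}^\perp$; $\mathcal{W}$ denotes the orthogonal complement of $\mathcal{W}^\perp$ in $\mathcal{S}$, so that $\mathcal{S}=\mathcal{W}\oplus\mathcal{W}^\perp$ (orthogonal sum). For a subspace $\mathcal{X}$, $\hat P_{\mathcal{X}}$ denotes the orthogonal projector onto $\mathcal{X}$. The vectors $u_i=v_i-\hat P_{\mathcal{W}^\perp}v_i=\hat P_{\mathcal{W}}v_i$, $i=1,\dots,M$, span $\mathcal{W}$. *)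

(* Defs.v *)
From HB Require Import structures.
From mathcomp Require Import all_boot all_order all_algebra.
From mathcomp Require Import all_classical all_reals all_analysis.
From mathcomp Require Import complex.

Set Implicit Arguments.
Unset Strict Implicit.
Unset Printing Implicit Defensive.

Import Order.TTheory GRing.Theory Num.Theory.
Import numFieldNormedType.Exports.

Local Open Scope classical_set_scope.
Local Open Scope ring_scope.

Section InnerProductSpace.
Variables (R : realType) (H : normedModType R[i]).
Implicit Types (form : {dot H for Num.conj}) (X Y : set H).

(* The library's positive definite forms are linear in the first argument and
   conjugate-linear in the second; flipping the arguments gives the opposite
   convention. *)
Definition inner form (x y : H) : R[i] := form y x.

(* Makes the norm of H, and hence its topology, the one induced by the inner
   product. *)
Definition norm_from form := forall x : H, `|x| ^+ 2 = inner form x x.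

Definition set_sum X Y : set H := [set x + y | x in X & y in Y].

Definition span_family (I : finType) (A : {set I}) (w : I -> H) : set H :=
  [set x | exists c : I -> R[i], x = \sum_(i in A) c i *: w i].

Definition ortho_compl_in form X Y : set H :=
  [set y | Y y /\ forall x, X x -> inner form x y = 0].

(* For a subspace X at most one p has this property.  As neither completeness
   of H nor finite dimension of X is assumed, there may be none: p exists
   exactly when x lies in the sum of X and its orthogonal complement; otherwise
   the value is the junk value 0. *)
Definition orth_proj form X (x : H) : H :=
  xget 0 [set p | X p /\ forall y, X y -> inner form y (x - p) = 0].

End InnerProductSpace.

(* Main.v *)
(* Write g = gamma_n.  One Gram-Schmidt step turns the projection of
   f onto W_k into the one onto W_(k+1): it adds (<g,f> / |g|^2) g.  Since u_n
   lies in W, so does g, and hence <g, P_W f> = <g, f>.  By Pythagoras the error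
   after selecting n is |P_W f - P_(W_k) f|^2 - (|<g,f>| / |g|)^2, whose first
   term does not depend on n. *)
Require Import Defs.
From HB Require Import structures.
From mathcomp Require Import all_boot all_order all_algebra.
From mathcomp Require Import all_classical all_reals all_analysis.
From mathcomp Require Import complex ring.

Set Implicit Arguments.
Unset Strict Implicit.
Unset Printing Implicit Defensive.

Import Order.TTheory GRing.Theory Num.Theory.
Import numFieldNormedType.Exports.

Local Open Scope classical_set_scope.
Local Open Scope ring_scope.

Section InnerProductLemmas.
Variables (R : realType) (H : normedModType R[i]).
Variable form : {dot H for Num.conj}.
Implicit Types (X Y : set H) (x y z : H) (a : R[i]).

Local Notation "''[' x , y ]" := (inner form x y) : ring_scope.

Lemma innerDl x y z : '[x + y, z] = '[x, z] + '[y, z].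
Proof. exact: linearDr. Qed.

Lemma innerDr x y z : '[x, y + z] = '[x, y] + '[x, z].
Proof. exact: linearDl. Qed.

Lemma innerBl x y z : '[x - y, z] = '[x, z] - '[y, z].
Proof. exact: linearBr. Qed.

Lemma innerBr x y z : '[x, y - z] = '[x, y] - '[x, z].
Proof. exact: linearBl. Qed.

Lemma innerZl a x y : '[a *: x, y] = a^* * '[x, y].
Proof. exact: linearZr_LR. Qed.

Lemma innerZr a x y : '[x, a *: y] = a * '[x, y].
Proof. exact: linearZl_LR. Qed.

Lemma inner0l x : '[0, x] = 0.
Proof. exact: linear0r. Qed.

Lemma inner0r x : '[x, 0] = 0.
Proof. exact: linear0l. Qed.

Lemma innerC x y : '[y, x] = '[x, y]^*.
Proof. by rewrite /inner hermC expr0 mul1r. Qed.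

Lemma inner_eq0C x y : '[x, y] = 0 -> '[y, x] = 0.
Proof. by move=> xy0; rewrite innerC xy0 conjC0. Qed.

Lemma inner_eq0 x : '[x, x] = 0 -> x = 0.
Proof.
move=> xx0; apply/eqP/negPn/negP => /(neq0_dnorm_gt0 (s := form)).
by rewrite -[form x x]/('[x, x]) xx0 ltxx.
Qed.

Lemma norm_inner x : norm_from form -> '[x, x] = `|x| ^+ 2.
Proof. by move=> ->. Qed.

(** Counterpart of [submod_closed] for classical sets, so that membership is a plain proposition
    [X x] instead of a boolean. *)
Definition subspace X := X 0 /\ forall a x y, X x -> X y -> X (a *: x + y).

Lemma submod_closed_subspace X : submod_closed (mem X) -> subspace X.
Proof.
move=> [X0 XP]; split=> [|a x y Xx Xy]; first by move: X0; rewrite inE.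
by move: (XP a x y); rewrite !inE; apply.
Qed.

Lemma subspaceD X x y : subspace X -> X x -> X y -> X (x + y).
Proof. by move=> [_ XP] Xx Xy; rewrite -(scale1r x); exact: XP. Qed.

Lemma subspaceZ X a x : subspace X -> X x -> X (a *: x).
Proof. by move=> [X0 XP] Xx; rewrite -[_ *: _]addr0; exact: XP. Qed.

Lemma subspaceB X x y : subspace X -> X x -> X y -> X (x - y).
Proof. by move=> [_ XP] Xx Xy; rewrite addrC -scaleN1r; exact: XP. Qed.

Lemma subspace_span_family (I : finType) (A : {set I}) (w : I -> H) :
  subspace (span_family A w).
Proof.
split=> [|a _ _ [c ->] [d ->]].
  by exists (fun=> 0); rewrite big1// => i _; rewrite scale0r.
exists (fun i => a * c i + d i).
rewrite scaler_sumr -big_split /=; apply: eq_bigr => i _.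
by rewrite scalerDl scalerA.
Qed.

Lemma span_family_gen (I : finType) (A : {set I}) (w : I -> H) i :
  i \in A -> span_family A w (w i).
Proof.
move=> iA; exists (fun j => (j == i)%:R); rewrite (big_setD1 i)//= eqxx scale1r.
rewrite big1 ?addr0// => j; rewrite !inE => /andP[/negbTE -> _].
by rewrite scale0r.
Qed.

Lemma span_family1 (I : finType) (w : I -> H) i :
  span_family [set i]%SET w = [set a *: w i | a in [set: R[i]]].
Proof.
apply/seteqP; split=> x [c].
  by rewrite big_set1 => ->; exists (c i).
by move=> _ <-; exists (fun=> c); rewrite big_set1.
Qed.

Lemma span_family_sub (I : finType) (A : {set I}) (w : I -> H) X :
  subspace X -> (forall i, i \in A -> X (w i)) -> span_family A w `<=` X.
Proof.
move=> Xsub Xw _ [c ->]; apply: (big_ind X) => [|x y Xx Xy|i iA].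
- by case: Xsub.
- exact: subspaceD.
- by apply: subspaceZ => //; exact: Xw.
Qed.

(** Puts a span in the form that [is_orth_proj_adjoin] produces, for induction on the number of
    generators. *)
Lemma span_familyD1 (I : finType) (A : {set I}) (w : I -> H) i : i \in A ->
  span_family A w =
  set_sum (span_family (A :\ i)%SET w) (span_family [set i]%SET w).
Proof.
move=> iA; apply/seteqP; split.
  move=> _ [c ->]; rewrite (big_setD1 i)//= addrC.
  exists (\sum_(j in (A :\ i)%SET) c j *: w j); first by exists c.
  by exists (c i *: w i) => //; exists c; rewrite big_set1.
have Asub := subspace_span_family A w.
move=> _ [x xA] [y yi] <-; apply: subspaceD => //.
  apply: (span_family_sub Asub) xA => j; rewrite !inE => /andP[_].
  exact: span_family_gen.
by apply: (span_family_sub Asub) yi => j /set1P ->; exact: span_family_gen.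
Qed.

Lemma subspace_set_sum X Y : subspace X -> subspace Y -> subspace (set_sum X Y).
Proof.
move=> Xsub Ysub; split.
  by exists 0; [case: Xsub | exists 0; [case: Ysub | rewrite addr0]].
move=> a _ _ [x Xx] [y Yy] <- [x' Xx'] [y' Yy'] <-.
exists (a *: x + x'); first by case: Xsub => _; apply.
exists (a *: y + y'); first by case: Ysub => _; apply.
by rewrite scalerDr addrACA.
Qed.

Lemma subspace_ortho_compl_in X Y :
  subspace Y -> subspace (ortho_compl_in form X Y).
Proof.
move=> Ysub; split; first by split; [case: Ysub | move=> x _; rewrite inner0r].
move=> a x y [Yx xX] [Yy yX]; split; first by case: Ysub => _; apply.
by move=> z Xz; rewrite innerDr innerZr xX// yX// mulr0 addr0.
Qed.

(** The property selected by [xget] in [orth_proj], isolated because existence must be proved before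
    the chosen value means anything. *)
Definition is_orth_proj X x p := X p /\ forall y, X y -> '[y, x - p] = 0.

Lemma orth_projE X x p : subspace X -> is_orth_proj X x p ->
  orth_proj form X x = p.
Proof.
move=> Xsub [Xp xp]; apply: xget_unique => // q [Xq xq].
apply/subr0_eq/inner_eq0.
have Xqp : X (q - p) by exact: subspaceB.
(* Both residuals are orthogonal to [X], which contains [q - p]; hence [q - p] is orthogonal to
   itself. *)
have {2}-> : q - p = (x - p) - (x - q) by rewrite opprB [RHS]addrC subrKA.
by rewrite innerBr xp// xq// subrr.
Qed.

Lemma orth_projP X x p : is_orth_proj X x p ->
  is_orth_proj X x (orth_proj form X x).
Proof. by move=> xp; apply: xgetPex; exists p. Qed.

(* When g = 0 the coefficient is the junk value 0, and p remains correct since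
   then u = q already lies in X. *)
Lemma is_orth_proj_adjoin (I : finType) (w : I -> H) i X x p q :
    subspace X -> is_orth_proj X x p -> is_orth_proj X (w i) q ->
  let g := w i - q in
  is_orth_proj (set_sum X (span_family [set i]%SET w)) x
    (p + ('[g, x] / '[g, g]) *: g).
Proof.
move=> Xsub [Xp xp] [Xq uq] g; set c := _ / _.
have gp : '[g, p] = 0 by apply/inner_eq0C/uq.
split.
  exists (p - c *: q); first by apply: subspaceB => //; exact: subspaceZ.
  exists (c *: w i); first by rewrite span_family1; exists c.
  by rewrite scalerBr addrAC addrA.
move=> _ [y Xy] [_] /[!span_family1] -[a _ <-] <-.
(* Split the test vector along [X] and [g]. The part in [X] is orthogonal to both [x - p] and [g];
   for the multiple of [g], the choice of [c] cancels the inner product. *)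
have -> : y + a *: w i = (y + a *: q) + a *: g.
  by rewrite scalerBr -addrA [a *: q + _]addrC subrK.
have Xz : X (y + a *: q) by apply: subspaceD => //; exact: subspaceZ.
rewrite innerDl opprD addrA innerBr xp// innerZr uq// mulr0 subrr add0r.
rewrite innerZl innerBr innerBr gp subr0 innerZr.
have [g0|g0] := eqVneq '[g, g] 0.
  by rewrite (inner_eq0 g0) !inner0l mulr0 subrr mulr0.
by rewrite divfK// subrr mulr0.
Qed.

(** Gram-Schmidt supplies existence without completeness: drop one generator, project, adjoin it
    again. *)
Lemma orth_proj_span_family (I : finType) (A : {set I}) (w : I -> H) x :
  is_orth_proj (span_family A w) x (orth_proj form (span_family A w) x).
Proof.
(* [x] stays general: the smaller span must receive projections of both [x] and the removed
   generator. *)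
have [n] := ubnP #|A|; elim: n => // n IHn in A x *; rewrite ltnS => leAn.
have [->|[i iA]] := set_0Vmem A.
  apply: (@orth_projP _ _ 0); split.
    by case: (subspace_span_family finset.set0 w).
  by move=> _ [c ->]; rewrite big_set0 inner0l.
rewrite (span_familyD1 _ iA).
have ltAn : (#|A :\ i| < n)%N by rewrite (cardsD1 i) iA in leAn.
apply: orth_projP; apply: is_orth_proj_adjoin; [|exact: IHn..].
exact: subspace_span_family.
Qed.

(** Here existence comes from the decomposition of [Y]: the two orthogonal summands of [x] are
    themselves its projections. *)
Lemma orth_proj_compl X Y x : subspace X -> subspace Y ->
    Y = set_sum (ortho_compl_in form X Y) X -> Y x ->
  is_orth_proj X x (orth_proj form X x) /\
  is_orth_proj (ortho_compl_in form X Y) x (x - orth_proj form X x).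
Proof.
move=> Xsub Ysub defY; rewrite {1}defY => -[w Ww] [y Xy] <-.
have projX : is_orth_proj X (w + y) y.
  by split=> // z Xz; rewrite addrK; case: Ww => _; apply.
rewrite (orth_projE Xsub projX); split=> //; rewrite addrK; split=> // z [_ zX].
by rewrite [w + y]addrC addrK; exact/inner_eq0C/zX.
Qed.

End InnerProductLemmas.

Theorem proposition3 (R : realType) (H : normedModType R[i])
    (form : {dot H for Num.conj}) (norm_form : norm_from form)
    (M : nat) (v : 'I_M -> H) (Wperp : set H)
    (Wperp_sub : submod_closed (mem Wperp)) (Wperp_closed : closed Wperp) :
  let V := span_family [set: 'I_M]%SET v in
  let S := set_sum V Wperp in
  let W := ortho_compl_in form Wperp S in
  V `&` Wperp = [set 0] ->
  S = set_sum W Wperp ->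
  forall f : H, S f ->
  let u i := v i - orth_proj form Wperp (v i) in
  forall (k : nat) (Jk : {set 'I_M}), #|Jk| = k ->
  let Wk := span_family Jk u in
  let gamma n := u n - orth_proj form Wk (u n) in
  let Wk1 n := set_sum Wk (span_family [set n]%SET u) in
  let admissible n := (n \notin Jk) && (gamma n != 0) in
  let err n := `|orth_proj form W f - orth_proj form (Wk1 n) f| ^+ 2 in
  let score n := `|inner form (gamma n) f| / `|gamma n| in
  forall l : 'I_M, admissible l ->
    (forall n, admissible n -> err l <= err n) <->
    (forall n, admissible n -> score n <= score l).
Proof.
move=> V S W _ defS f Sf u k Jk _ Wk gamma Wk1 admissible err score l adm_l.
have Psub := submod_closed_subspace Wperp_sub.
have Ssub : subspace S.
  exact: subspace_set_sum (subspace_span_family _ _) Psub.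
have Wsub : subspace W := subspace_ortho_compl_in form Wperp Ssub.
have Wksub : subspace Wk := subspace_span_family _ _.
have Wu i : W (u i).
  have Sv : S (v i).
    exists (v i); first by apply: span_family_gen; rewrite inE.
    by exists 0; [case: Psub | rewrite addr0].
  by have [_ []] := orth_proj_compl Psub Ssub defS Sv.
have [_ projW] := orth_proj_compl Psub Ssub defS Sf.
move/(orth_projE Wsub): (projW); set fW := (f - _) in projW * => PWf.
set p := orth_proj form Wk f.
have projp : is_orth_proj form Wk f p := orth_proj_span_family _ _ _ _.
have errE n : gamma n != 0 -> err n = `|fW - p| ^+ 2 - score n ^+ 2.
  move=> gn0; set g := gamma n.
  have projq := orth_proj_span_family form Jk u (u n).
  have Wg : W g.
    by apply: subspaceB => //; apply: span_family_sub projq.1 => // i _.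
  have Wk1sub : subspace (Wk1 n).
    exact: subspace_set_sum Wksub (subspace_span_family _ _).
  rewrite /err PWf (orth_projE Wk1sub (is_orth_proj_adjoin Wksub projp projq)).
  rewrite -/(gamma n) -/g /score -/g opprD addrA; set e := fW - p.
  (* [g] is orthogonal to [Wk], hence to [p], and lies in [W], hence is orthogonal to [f - fW]. *)
  have ge : inner form g e = inner form g f.
    have gp : inner form g p = 0 by apply/inner_eq0C/projq.2/projp.1.
    have /eqP := projW.2 _ Wg; rewrite innerBr subr_eq0 => /eqP ->.
    by rewrite innerBr gp subr0.
  have g0 : `|g| != 0 by rewrite normr_eq0.
  clearbody e g; rewrite (norm_inner g norm_form).
  set b := inner form g f; set c := b / _.
  (* The denominator is real, so conjugation affects only [b]. *)
  have cC : c^* = b^* / `|g| ^+ 2.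
    apply: etrans (fmorph_div _ _ _) _; congr (_ / _).
    by apply: conj_Creal; rewrite realX.
  rewrite -(norm_inner _ norm_form) !innerBl !innerBr !innerZl !innerZr.
  rewrite cC (innerC _ g e) ge -/b !(norm_inner _ norm_form).
  by rewrite expr_div_n normCK /c; field.
suff le_err n : admissible n -> (err l <= err n) = (score n <= score l).
  by split=> + n adm_n => /(_ n adm_n); rewrite le_err.
move=> /andP[_ gn0]; rewrite !errE//; last by case/andP: adm_l.
(* The order on [R[i]] is only partial, but squaring still preserves and reflects it on the
   nonnegative scores. *)
by rewrite lerD2l lerN2 ler_pXn2r// nnegrE divr_ge0.
Qed.
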